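(* Let $A$ be an abelian variety over $\mathbb{F}_q$, with angle rank $\delta=\delta_A$ and angle torsion order $m=m_A$. Then $\mathrm{SF}(A)\cong\mathrm{U}(1)^{\delta}\times C_m$ as topological groups. Furthermore, the identity component of $\mathrm{SF}(A)$ equals $\mathrm{SF}(A_{(m)})$ (as subgroups of $\mathrm{U}(1)^g$), and $\mathrm{SF}(A)/\mathrm{SF}(A)^\circ\cong C_m$.
   Context: Let $q=p^d$ with $p$ prime. For an abelian variety $A$ of dimension $g$ over $\mathbb{F}_q$, let $P_A(T)$ be the characteristic polynomial of Frobenius (on an $\ell$-adic Tate module); its roots, listed with multiplicity, are $\alpha_1,\dots,\alpha_g,\bar\alpha_1,\dots,\bar\alpha_g$ with $|\alpha_j|=\sqrt q$ and $\arg(\alpha_i)\ge\arg(\alpha_j)$ for $i>j$; put $u_j=\alpha_j/\sqrt q\in\mathrm{U}(1)$. The Serre–Frobenius group $\mathrm{SF}(A)$ is the closure in $\mathrm{U}(1)^g$ of the subgroup generated by $(u_1,\dots,u_g)$. The angle group $U_A$ is the subgroup of $\mathbb{C}^\times$ generated by $u_1,\dots,u_g$; writing $U_A\cong\mathbb{Z}^{\delta_A}\oplus\mathbb{Z}/m_A\mathbb{Z}$, $\delta_A$ is the angle rank and $m_A$ the angle torsion order. $A_{(r)}$ denotes the base change of $A$ to $\mathbb{F}_{q^r}$ (its normalized eigenvalues are $u_1^r,\dots,u_g^r$). $C_m$ is the cyclic group of order $m$. *)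

(* Defs.v *)
From HB Require Import structures.
From mathcomp Require Import all_boot all_order all_algebra.
From mathcomp Require Import all_classical all_reals all_analysis.
From mathcomp Require Import complex.
Import numFieldTopology.Exports numFieldNormedType.Exports.
Set Implicit Arguments.
Unset Strict Implicit.
Unset Printing Implicit Defensive.
Import Order.TTheory GRing.Theory Num.Theory.
Local Open Scope ring_scope.
Local Open Scope classical_set_scope.

(* The complex numbers over a real field R, seen as a numClosedFieldType so
   that MathComp-Analysis equips it (and 'rV[CC R]_n, products) with its
   norm topology. *)
Definition CC (R : realType) : numClosedFieldType := R[i]%C.

Section Defs.
Variable R : realType.
Local Notation C := (CC R).

Definition rmul (n : nat) (x y : 'rV[C]_n) : 'rV[C]_n :=
  \row_j (x 0 j * y 0 j).

Definition rexp (n : nat) (x : 'rV[C]_n) (k : int) : 'rV[C]_n :=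
  \row_j (x 0 j ^ k).

Definition torus (n : nat) : set 'rV[C]_n :=
  [set x | forall j, `|x 0 j| = 1].

(* group of m-th roots of unity in C : a cyclic group of order m (for m > 0) *)
Definition mu (m : nat) : set C := [set z | z ^+ m = 1].

(* Serre-Frobenius group attached to the normalized eigenvalues u :
   closure in U(1)^n of the (cyclic) subgroup generated by u. *)
Definition SFgroup (n : nat) (u : 'rV[C]_n) : set 'rV[C]_n :=
  closure [set rexp u k | k in [set: int]].

Definition angle_group (n : nat) (u : 'rV[C]_n) : set C :=
  [set \prod_(j < n) u 0 j ^ (a j) | a in [set: 'I_n -> int]].

(* "U ≅ Z^delta ⊕ Z/mZ": there is a group homomorphism
   f : Z^delta x Z -> C^x whose image is U and whose kernel is 0 x mZ. *)
Definition angle_decomp (n : nat) (u : 'rV[C]_n) (delta m : nat) : Prop :=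
  exists f : ('I_delta -> int) -> int -> C,
    [/\ forall a b k l, f (fun i => a i + b i) (k + l) = f a k * f b l,
        forall a k, f a k = 1 <-> ((forall i, a i = 0) /\ (m%:Z %| k)%Z) &
        [set z | exists a k, f a k = z]
          = angle_group u].

Definition topgroup_iso (n delta : nat) (A : set 'rV[C]_n)
    (B : set ('rV[C]_delta * C)%type) : Prop :=
  exists (phi : 'rV[C]_n -> ('rV[C]_delta * C)%type)
         (psi : ('rV[C]_delta * C)%type -> 'rV[C]_n),
    [/\ (forall x, A x -> B (phi x)) /\ (forall y, B y -> A (psi y)),
        (forall x, A x -> psi (phi x) = x) /\ (forall y, B y -> phi (psi y) = y),
        forall x y, A x -> A y ->
          phi (rmul x y) = (rmul (phi x).1 (phi y).1, (phi x).2 * (phi y).2),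
        {within A, continuous phi} &
        {within B, continuous psi}].

Definition coset (n : nat) (H : set 'rV[C]_n) (x : 'rV[C]_n) : set 'rV[C]_n :=
  [set rmul x h | h in H].

(* the quotient group G/H is isomorphic to mu_m (cyclic of order m):
   a bijection F from the set of cosets {xH | x in G} onto mu_m that is
   multiplicative, (xH)(yH) = (xy)H. *)
Definition quotient_iso_mu (n m : nat) (G H : set 'rV[C]_n) : Prop :=
  exists F : set 'rV[C]_n -> C,
    [/\ forall x, G x -> mu m (F (coset H x)),
        forall x y, G x -> G y -> F (coset H x) = F (coset H y) ->
          coset H x = coset H y,
        (forall z, mu m z -> exists2 x, G x & F (coset H x) = z) &
        forall x y, G x -> G y ->
          F (coset H (rmul x y)) = F (coset H x) * F (coset H y)].

End Defs.

(* Main.v *)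
Require Import Defs.
From HB Require Import structures.
From mathcomp Require Import all_boot all_order all_algebra.
From mathcomp Require Import all_classical all_reals all_analysis.
From mathcomp Require Import complex ring zify.
Import numFieldTopology.Exports numFieldNormedType.Exports.
Import Order.TTheory GRing.Theory Num.Theory.
Local Open Scope ring_scope.
Local Open Scope classical_set_scope.

Set Implicit Arguments.
Unset Strict Implicit.
Unset Printing Implicit Defensive.

(** A decomposition of the angle group provides multiplicatively independent
    numbers v_1, .., v_delta and a primitive m-th root of unity zeta such that
    each u_j is a monomial in (v, zeta) and each v_i, as well as zeta, is a
    monomial in u.  The two monomial maps are continuous homomorphisms exchanging
    u and (v, zeta), so they identify SF(A), the closure of the powers of u, with
    the closure of the powers of (v, zeta).  The latter is all of
    U(1)^delta x mu_m, because by Kronecker's theorem the powers of v^m are dense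
    in U(1)^delta.  The identity component corresponds to U(1)^delta x {1}, the
    closure of the powers of (v, zeta)^m.

    Kronecker's theorem is proved following Bohr: if the powers of w stayed away
    from y, then F(k) = 1 + \sum_i w_i^k / y_i would be bounded in norm by some
    M < n + 1; averaging F(k)^N times a conjugate character over k isolates the
    multinomial coefficients, each at most M^N, whereas they sum up to (n + 1)^N
    and their number is polynomial in N. *)

(** * Kronecker's theorem *)

Lemma CC_archi (R : realType) (x : CC R) : exists n : nat, `|x| < n%:R.
Proof.
rewrite [`|x|]normc_def; set r := Num.sqrt _; exists (Num.bound r).
rewrite -(rmorph_nat (real_complex R)) ltcR.
by apply: le_lt_trans (archi_boundP _); rewrite ?ler_norm ?sqrtr_ge0.
Qed.

(** The sum telescopes after multiplication by [z - 1]. The bound does not depend on [L], so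
    nontrivial characters contribute a bounded error to the averages below. *)
Lemma norm_geometric_sum_le (C : numFieldType) (z : C) (L : nat) :
  `|z| = 1 -> z != 1 -> `|\sum_(k < L) z ^+ k| <= 2 / `|z - 1|.
Proof.
move=> z1 zN1; rewrite ler_pdivlMr ?normr_gt0 ?subr_eq0// mulrC -normrM -subrX1.
by apply: le_trans (ler_normB _ _) _; rewrite normrX z1 expr1n normr1.
Qed.

(** Stands in for dividing by [L] and letting [L] tend to infinity: a fixed [c] cannot make up for
    [L] times a positive gap [a - b]. *)
Lemma le_of_linear_bound (R : realType) (a b c : CC R) :
  a \is Num.real -> b \is Num.real -> 0 <= c ->
  (forall L : nat, L%:R * a <= L%:R * b + c) -> a <= b.
Proof.
move=> ra rb c0 Lab; rewrite real_leNgt//; apply/negP => ltba.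
have d0 : 0 < a - b by rewrite subr_gt0.
have [L] := CC_archi (c / (a - b)).
rewrite (ger0_norm (divr_ge0 c0 (ltW d0))) ltr_pdivrMr// mulrBr ltrBrDl.
by move=> /lt_le_trans /(_ (Lab L)); rewrite ltxx.
Qed.

(** * Bohr's averaging argument *)

Section BohrInequality.
Variables (R : realType) (I : finType).
Local Notation C := (CC R).
Variables (w y : I -> C).
Hypothesis w1 : forall i, `|w i| = 1.
Hypothesis y1 : forall i, `|y i| = 1.
Variable N : nat.
Local Notation word := {ffun 'I_N -> I}.

Let count (s : word) (x : I) : nat := #|[pred i | s i == x]|.

Lemma prod_word_count (t : I -> C) (s : word) :
  \prod_(i < N) t (s i) = \prod_x t x ^+ count s x.
Proof.
rewrite (partition_big s xpredT)//=; apply: eq_bigr => x _.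
by rewrite (eq_bigr (fun=> t x)) ?prodr_const// => i /eqP ->.
Qed.

(** Only monomials of the same total degree are compared, so the value 1 may occur among the [w x];
    it will carry the constant term of Bohr's function. *)
Hypothesis w_indep : forall a b : I -> nat,
  (\sum_x a x = \sum_x b x)%N -> \prod_x w x ^+ a x = \prod_x w x ^+ b x ->
  a =1 b.

Variable M : C.
Hypothesis M0 : 0 <= M.
Hypothesis leM : forall k : nat, `|\sum_x y x * w x ^+ k| <= M.

Lemma sum_count (s : word) : (\sum_x count s x = N)%N.
Proof.
rewrite -[RHS]card_ord -sum1_card (partition_big s xpredT)//=.
by apply: eq_bigr => x _; rewrite sum1_card.
Qed.

Let W (s : word) := \prod_(i < N) w (s i).
Let Y (s : word) := \prod_(i < N) y (s i).

Lemma norm_prod1 (t : 'I_N -> C) :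
  (forall i, `|t i| = 1) -> `|\prod_i t i| = 1.
Proof. by move=> t1; rewrite normr_prod big1. Qed.

(* Averaging F(k)^N / (Y t * W t ^+ k) over k < L keeps exactly the words with
   the same letter counts as t, up to an error bounded independently of L. *)
Lemma card_count_class (t : word) :
  (#|[pred s : word | [forall x, count s x == count t x]]|)%:R <= M ^+ N.
Proof.
set K := [pred s | _].
have Y1 s : `|Y s| = 1 by apply: norm_prod1.
have W1 s : `|W s| = 1 by apply: norm_prod1.
have Y0 s : Y s != 0 by rewrite -normr_eq0 Y1 oner_eq0.
have W0 s : W s != 0 by rewrite -normr_eq0 W1 oner_eq0.
have KP s : s \in K -> Y s = Y t /\ W s = W t.
  move=> /forallP sK; rewrite /Y /W !prod_word_count.
  by split; apply: eq_bigr => x _; rewrite (eqP (sK x)).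
(* Both words have length [N], so equal values of [W] would force equal letter counts. *)
have WK s : s \notin K -> W s / W t != 1.
  apply: contraNneq => /(congr1 ( *%R^~ (W t))); rewrite divfK// mul1r => sWt.
  apply/forallP => x; apply/eqP; apply: w_indep; first by rewrite !sum_count.
  by rewrite -!prod_word_count.
pose z s := W s / W t.
have z1 s : `|z s| = 1 by rewrite normrM normfV !W1 divr1.
pose B := \sum_(s | s \notin K) 2 / `|z s - 1|.
apply: (@le_of_linear_bound _ _ _ B).
- exact: realn.
- by rewrite ger0_real// exprn_ge0.
- by apply: sumr_ge0 => s _; rewrite divr_ge0.
move=> L.
(* The [N]-th power expands into a sum over all words of length [N], here twisted by the character
   of [t]. *)
have expand k : (\sum_x y x * w x ^+ k) ^+ N / Y t / W t ^+ k =
    \sum_s Y s / Y t * z s ^+ k.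
  rewrite -[in LHS](card_ord N) -prodr_const bigA_distr_bigA/= !mulr_suml.
  apply: eq_bigr => s _; rewrite big_split/= prodrXl exprMn exprVn.
  by rewrite -/(W s) -/(Y s) mulrACA !mulrA.
(* Each word of [K] contributes 1 for every [k]; each other word contributes a geometric sum of
   ratio [z s != 1]. *)
have splitE : \sum_(k < L) (\sum_x y x * w x ^+ k) ^+ N / Y t / W t ^+ k =
    L%:R * #|K|%:R + \sum_(s | s \notin K) Y s / Y t * \sum_(k < L) z s ^+ k.
  under eq_bigr do rewrite expand.
  rewrite exchange_big/= (bigID (mem K))/=; congr (_ + _); last first.
    by apply: eq_bigr => s _; rewrite mulr_sumr.
  rewrite (eq_bigr (fun=> L%:R)) ?sumr_const ?mulr_natr// => s /KP[YE WE].
  rewrite (eq_bigr (fun=> 1)) ?sumr_const ?card_ord// => k _.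
  by rewrite /z YE WE !divff// expr1n mulr1.
have -> : L%:R * #|K|%:R = `|L%:R * #|K|%:R : C|.
  by rewrite ger0_norm// mulr_ge0.
have /eqP := splitE; rewrite -subr_eq => /eqP <-.
apply: le_trans (ler_normB _ _) _; apply: lerD.
  apply: le_trans (ler_norm_sum _ _ _) _.
  rewrite -[X in X%:R * _](card_ord L) mulr_natl -sumr_const.
  apply: ler_sum => k _; rewrite !normrM !normfV !normrX Y1 W1 expr1n !divr1.
  by rewrite lerXn2r// nnegrE.
apply: le_trans (ler_norm_sum _ _ _) _; apply: ler_sum => s sK.
rewrite normrM normrM normfV !Y1 divr1 mul1r.
by apply: norm_geometric_sum_le => //; apply: WK.
Qed.

(** The words of length [N] are sorted by their letter counts: each class has at most [M ^+ N]
    members, and a count is one of [N.+1] values for each letter. *)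
Lemma Bohr_inequality : (#|I| ^ N)%:R <= (N.+1 ^ #|I|)%:R * M ^+ N.
Proof.
pose cl (s : word) : {ffun I -> 'I_N.+1} := [ffun x => inord (count s x)].
have clE s x : cl s x = count s x :> nat.
  rewrite ffunE inordK// ltnS -[X in (_ <= X)%N]card_ord; exact: max_card.
have -> : (#|I| ^ N = #|word|)%N by rewrite card_ffun card_ord.
have -> : (N.+1 ^ #|I| = #|{ffun I -> 'I_N.+1}|)%N.
  by rewrite card_ffun card_ord.
rewrite -sum1_card (partition_big cl xpredT)// natr_sum mulr_natl -sumr_const.
apply: ler_sum => c _; rewrite sum1_card.
have [t /eqP tc|none] := pickP [pred s : word | cl s == c]; last first.
  by rewrite eq_card0// exprn_ge0.
apply: le_trans (card_count_class t); rewrite ler_nat; apply: subset_leq_card.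
apply/fintype.subsetP => s sc; rewrite inE; apply/forallP => x; apply/eqP.
have {}sc : cl s = c by apply/eqP.
by rewrite -!clE sc tc.
Qed.

End BohrInequality.

(** * Growth and norm estimates, and the density theorem *)

(** With [N = K.+1 * q.+1], Bernoulli's inequality for [x ^+ K.+1] gives a lower bound of degree
    [q.+1] in [K.+1], while [N.+1 ^ q] has degree only [q]. The constant [c] is the ratio of the two
    leading coefficients. *)
Lemma exp_gt_poly (R : archiRealFieldType) (x : R) (q : nat) :
  1 < x -> exists N : nat, (N.+1 ^ q)%:R < x ^+ N.
Proof.
move=> x1; pose h := x - 1; have h0 : 0 < h by rewrite subr_gt0.
pose c := (2 * q.+1)%:R ^+ q / h ^+ q.+1.
have c0 : 0 < c by rewrite divr_gt0 ?exprn_gt0// ltr0n muln_gt0.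
have [K cK] : exists K : nat, c < K.+1%:R.
  exists (Num.bound c); apply: lt_le_trans (archi_boundP (ltW c0)) _.
  by rewrite ler_nat.
exists (K.+1 * q.+1)%N.
have bernoulli n : n%:R * h <= x ^+ n.
  elim: n => [|n IHn]; first by rewrite mul0r expr0.
  rewrite exprS -natr1 mulrDl mul1r addrC.
  have -> : x * x ^+ n = h * x ^+ n + x ^+ n by rewrite /h; ring.
  rewrite lerD// ler_peMr ?(ltW h0)//.
  by rewrite exprn_ege1 ?ltW.
rewrite exprM; apply: lt_le_trans (_ : (K.+1%:R * h) ^+ q.+1 <= _); last first.
  have x0 : 0 <= x := le_trans ler01 (ltW x1).
  by rewrite lerXn2r ?nnegrE ?bernoulli ?exprn_ge0 ?mulr_ge0 ?(ltW h0).
apply: le_lt_trans (_ : ((2 * q.+1)%:R * K.+1%:R) ^+ q < _).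
  rewrite -natrM -natrX ler_nat; case: (q) => [//|q'].
  rewrite leq_exp2r// -mulnA (mulnC q'.+2).
  by have : (0 < K.+1 * q'.+2)%N by []; lia.
rewrite !exprMn; move: cK; rewrite /c ltr_pdivrMr ?exprn_gt0// => cK.
by rewrite [X in _ < X * _]exprS mulrAC ltr_pM2r ?exprn_gt0.
Qed.

(** By the parallelogram law the square of the left side is [4 - |z - 1|^2], and [4 - e ^+ 2] is at
    most the square of [2 - e ^+ 2 / 4]. *)
Lemma ler_norm1D (C : numClosedFieldType) (z e : C) :
  `|z| = 1 -> 0 <= e <= 1 -> e <= `|z - 1| -> `|1 + z| <= 2 - e ^+ 2 / 4.
Proof.
move=> z1 /andP[e0 e1] ez.
have e21 : e ^+ 2 <= 1 by rewrite expr_le1.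
have b0 : 0 <= 2 - e ^+ 2 / 4.
  rewrite subr_ge0 ler_pdivrMr//; apply: le_trans e21 _.
  by rewrite -natrM ler1n.
rewrite -(@ler_pXn2r _ 2)// ?nnegrE//.
have par : `|1 + z| ^+ 2 = 4 - `|z - 1| ^+ 2.
  have zz : z * z^* = 1 by rewrite -normCK z1 expr1n.
  rewrite !normCK !rmorphD rmorphN rmorph1 /=.
  set t := z^* in zz *; apply/eqP; rewrite -subr_eq0.
  have -> : (1 + z) * (1 + t) - (4 - (z - 1) * (t - 1)) = 2 * (z * t) - 2.
    by ring.
  by rewrite zz mulr1 subrr.
rewrite par; apply: le_trans (_ : 4 - e ^+ 2 <= _).
  by rewrite lerD2l lerN2 lerXn2r ?nnegrE.
have -> : (2 - e ^+ 2 / 4) ^+ 2 = 4 - e ^+ 2 + (e ^+ 2 / 4) ^+ 2 by field.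
by rewrite lerDl exprn_ge0 ?divr_ge0 ?exprn_ge0.
Qed.

Lemma Kronecker_density (R : realType) (n : nat) (w y : 'I_n -> CC R)
    (e : CC R) :
  (forall i, `|w i| = 1) -> (forall i, `|y i| = 1) ->
  (forall a : 'I_n -> int, \prod_i w i ^ a i = 1 -> forall i, a i = 0) ->
  0 < e -> exists k : nat, forall i, `|w i ^+ k - y i| < e.
Proof.
move=> w1 y1 w_indep; wlog e1 : e / e <= 1 => [small e0|].
  have [e1|e1] := real_leP (gtr0_real e0) (@real1 (CC R)); first exact: small.
  have [k kP] := small 1 (lexx _) ltr01.
  by exists k => i; exact: lt_trans (kP i) e1.
move=> e0; apply/not_existsP => far.
have {}far k : exists i, e <= `|w i ^+ k - y i|.
  have /existsNP[i /negP] := far k.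
  rewrite -real_leNgt ?normr_real ?gtr0_real//.
  by exists i.
(* The index [ord0] carries the constant term 1 of Bohr's function, and the coefficients [y'] rotate
   each target to 1. *)
pose w' (x : 'I_n.+1) := oapp w 1 (unlift ord0 x).
pose y' (x : 'I_n.+1) := oapp (fun i => (y i)^-1) 1 (unlift ord0 x).
have w'0 : w' ord0 = 1 by rewrite /w' unlift_none.
have w'S i : w' (lift ord0 i) = w i by rewrite /w' liftK.
have y'0 : y' ord0 = 1 by rewrite /y' unlift_none.
have y'S i : y' (lift ord0 i) = (y i)^-1 by rewrite /y' liftK.
(* For each [k] some coordinate [i] is far from its target. Its term and the constant 1 add up to
   norm at most [2 - e ^+ 2 / 4]; the other [n.-1] terms have norm 1. *)
pose M := n.+1%:R - e ^+ 2 / 4.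
have M0 : 0 < M.
  rewrite subr_gt0 ltr_pdivrMr//; apply: le_lt_trans (_ : 1 < _).
    by rewrite expr_le1// ltW.
  by rewrite -natrM ltr1n.
have leM k : `|\sum_x y' x * w' x ^+ k| <= M.
  have [i ei] := far k; rewrite big_ord_recl w'0 y'0 expr1n mulr1.
  rewrite (bigD1 i)//= addrA; apply: le_trans (ler_normD _ _) _.
  rewrite w'S y'S; pose z := (y i)^-1 * w i ^+ k.
  have z1 : `|z| = 1.
    by rewrite normrM normfV normrX y1 w1 expr1n invr1 mulr1.
  have zi : e <= `|z - 1|.
    suff -> : `|z - 1| = `|w i ^+ k - y i| by [].
    have y0 : y i != 0 by rewrite -normr_eq0 y1 oner_eq0.
    have -> : w i ^+ k - y i = y i * (z - 1) by rewrite mulrBr mulr1 mulVKf.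
    by rewrite normrM y1 mul1r.
  have rest : `|\sum_(j < n | j != i) y' (lift ord0 j) * w' (lift ord0 j) ^+ k|
      <= n.-1%:R.
    apply: le_trans (ler_norm_sum _ _ _) _.
    rewrite (eq_bigr (fun=> 1)); last first.
      move=> j _; rewrite w'S y'S normrM normrX.
      by rewrite normfV y1 w1 expr1n invr1 mulr1.
    by rewrite sumr_const cardC1 card_ord.
  apply: le_trans (lerD (ler_norm1D z1 _ zi) rest) _; first by rewrite ltW.
  have -> : M = 2 + n.-1%:R - e ^+ 2 / 4.
    by rewrite /M -natrD; congr (_%:R - _); have := ltn_ord i; lia.
  by rewrite [X in _ <= X]addrAC.
(* The ratio [n.+1 / M] exceeds 1, so its powers outgrow the polynomial factor of Bohr's inequality
   for [n.+1] letters. *)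
have [|N ltN] := @exp_gt_poly R (n.+1%:R / complex.Re M) n.+1.
  have := M0; rewrite -(RRe_real (gtr0_real M0)) ltcR => rM0.
  rewrite ltr_pdivlMr// mul1r -ltcR RRe_real ?gtr0_real//.
  rewrite rmorph_nat /M gtrBl divr_gt0// exprn_gt0//.
have w'1 x : `|w' x| = 1.
  by case: (unliftP ord0 x) => [j|] ->; rewrite ?w'S ?w'0 ?normr1.
have y'1 x : `|y' x| = 1.
  by case: (unliftP ord0 x) => [j|] ->;
    rewrite ?y'S ?y'0 ?normfV ?y1 ?normr1 ?invr1.
have w0 i : w i != 0 by rewrite -normr_eq0 w1 oner_eq0.
(* Independence of [w] settles every index but [ord0], where equality follows from the equal
   totals. *)
have w'_indep (a b : 'I_n.+1 -> nat) : (\sum_x a x = \sum_x b x)%N ->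
    \prod_x w' x ^+ a x = \prod_x w' x ^+ b x -> a =1 b.
  rewrite !big_ord_recl w'0 !expr1n !mul1r => sab pab.
  have abS i : a (lift ord0 i) = b (lift ord0 i).
    pose c i : int := (a (lift ord0 i))%:Z - (b (lift ord0 i))%:Z.
    suff /w_indep/(_ i)/eqP : \prod_i w i ^ c i = 1.
      by rewrite subr_eq0 => /eqP[].
    rewrite (eq_bigr (fun i => w' (lift ord0 i) ^+ a (lift ord0 i) /
        w' (lift ord0 i) ^+ b (lift ord0 i))).
      rewrite prodf_div pab divff//; apply/prodf_neq0 => j _.
      by rewrite w'S expf_neq0.
    by move=> j _; rewrite w'S expfzDr// -invr_expz -!exprnP.
  move: sab; rewrite (eq_bigr _ (fun i _ => abS i)) => /addIn ab0 x.
  by case: (unliftP ord0 x) => [j|] ->.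
have := Bohr_inequality w'1 y'1 N w'_indep (ltW M0) leM.
rewrite card_ord; apply/negP; rewrite -real_ltNge ?realn//; last first.
  by rewrite rpredM ?realn// rpredX ?gtr0_real.
move: ltN (M0); rewrite -(RRe_real (gtr0_real M0)) ltcR /= => ltN rM0.
rewrite -(rmorph_nat (real_complex R)) -rmorphXn -(rmorph_nat (real_complex R)).
rewrite -rmorphM ltcR -ltr_pdivlMr ?exprn_gt0//.
by rewrite [X in _ < X / _]natrX -expr_div_n.
Qed.

(** * Monomial maps on tori *)

Section ClosureContinuity.
Variables (T U : topologicalType).

Lemma closure_image_at (A : set T) (f : T -> U) (x : T) :
  closure A x -> {for x, continuous f} -> closure (f @` A) (f x).
Proof.
move=> Ax cf B /cf fB; have [t [At Bt]] := Ax _ fB.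
by exists (f t); split => //; exists t.
Qed.

(** Extends identities from the powers of a point to their closure. Continuity is asked at [x] only,
    since monomials with negative exponents are not continuous where a coordinate vanishes. *)
Lemma closure_eq_at (A : set T) (f g : T -> U) (x : T) : hausdorff_space U ->
  closure A x -> {for x, continuous f} -> {for x, continuous g} ->
  (forall t, A t -> f t = g t) -> f x = g x.
Proof.
move=> hU Ax cf cg fg; apply: hU => B D fB gD.
have {}fB : nbhs x (f @^-1` B) := cf _ fB.
have {}gD : nbhs x (g @^-1` D) := cg _ gD.
have [t [At [Bt Dt]]] := Ax _ (filterI fB gD).
by exists (f t); split => //; rewrite /= fg.
Qed.

Lemma continuous_at_row (K : topologicalType) (n : nat) (f : T -> 'rV[K]_n)
    (x : T) :
  (forall j, {for x, continuous (fun t => f t 0 j)}) -> {for x, continuous f}.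
Proof.
move=> cf B [P Pf PB].
have : nbhs x [set t | forall j, P 0 j (f t 0 j)].
  by apply: filter_forall => j; exact: (cf j _ (Pf 0 j)).
by apply: filterS => t Pt; apply: PB => i j; rewrite ord1; exact: Pt.
Qed.

Lemma continuous_at_exprz (K : numFieldType) (f : T -> K) (k : int) (x : T) :
  {for x, continuous f} -> f x != 0 -> {for x, continuous (fun t => f t ^ k)}.
Proof.
move=> cf f0.
have cX n : {for x, continuous (fun t => f t ^+ n)}.
  elim: n => [|n IHn]; first exact: cvg_cst.
  rewrite /prop_for /continuous_at exprS; under eq_fun do rewrite exprS.
  exact: cvgM.
case: k => n; first exact: cX.
by apply: cvgV (cX n.+1); rewrite expf_neq0.
Qed.

Lemma continuous_at_prod (K : numFieldType) (I : finType) (f : I -> T -> K)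
    (x : T) :
  (forall i, {for x, continuous (f i)}) ->
  {for x, continuous (fun t => \prod_i f i t)}.
Proof.
move=> cf; rewrite /index_enum; elim: (Finite.enum I) => [|i s IHs].
  rewrite /prop_for /continuous_at big_nil; under eq_fun do rewrite big_nil.
  exact: cvg_cst.
rewrite /prop_for /continuous_at big_cons; under eq_fun do rewrite big_cons.
by apply: cvgM => //; exact: cf.
Qed.

End ClosureContinuity.

Section Monomials.
Variable R : realType.
Local Notation C := (CC R).

Lemma CC_hausdorff : hausdorff_space C.
Proof. exact: norm_hausdorff. Qed.

Definition monomial n (a : 'I_n -> int) (x : 'rV[C]_n) : C :=
  \prod_j x 0 j ^ a j.

Lemma torus_neq0 n (x : 'rV[C]_n) j : torus x -> x 0 j != 0.
Proof. by move=> xT; rewrite -normr_eq0 xT oner_eq0. Qed.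

Lemma torus1 n : torus (const_mx 1 : 'rV[C]_n).
Proof. by move=> j; rewrite mxE normr1. Qed.

Lemma norm_exprz1 (z : C) (k : int) : `|z| = 1 -> `|z ^ k| = 1.
Proof.
by move=> z1; case: k => n; rewrite ?normfV normrX z1 expr1n ?invr1.
Qed.

Lemma torus_rmul n (x y : 'rV[C]_n) : torus x -> torus y -> torus (rmul x y).
Proof. by move=> xT yT j; rewrite mxE normrM xT yT mulr1. Qed.

Lemma torus_rexp n (x : 'rV[C]_n) k : torus x -> torus (rexp x k).
Proof. by move=> xT j; rewrite mxE norm_exprz1. Qed.

Lemma torus_closure n (A : set 'rV[C]_n) :
  A `<=` @torus R n -> closure A `<=` @torus R n.
Proof.
move=> AT x Ax j.
apply: (closure_eq_at (f := fun t : 'rV[C]_n => `|t 0 j|) (g := fun=> 1 : C)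
  CC_hausdorff Ax).
- apply: (@continuous_comp _ _ _ (fun t : 'rV[C]_n => t 0 j) (@Num.norm C C)).
    exact: coord_continuous.
  exact: norm_continuous.
- exact: cst_continuous.
- by move=> t /AT ->.
Qed.

Lemma monomialM n (a : 'I_n -> int) (x y : 'rV[C]_n) :
  monomial a (rmul x y) = monomial a x * monomial a y.
Proof.
by rewrite /monomial -big_split; apply: eq_bigr => j _; rewrite mxE expfzMl.
Qed.

Lemma monomial_rexp n (a : 'I_n -> int) (x : 'rV[C]_n) k :
  monomial a (rexp x k) = monomial a x ^ k.
Proof.
rewrite /monomial.
rewrite (big_morph (fun z => z ^ k) (fun z t => expfzMl z t k) (exp1rz _ k)).
by apply: eq_bigr => j _; rewrite mxE !exprz_exp mulrC.
Qed.

Lemma norm_monomial n (a : 'I_n -> int) (x : 'rV[C]_n) :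
  torus x -> `|monomial a x| = 1.
Proof. by move=> xT; rewrite normr_prod big1// => j _; rewrite norm_exprz1. Qed.

Lemma monomial_continuous n (a : 'I_n -> int) (x : 'rV[C]_n) :
  torus x -> {for x, continuous (monomial a)}.
Proof.
move=> xT; apply: continuous_at_prod => j.
apply: continuous_at_exprz; last exact: torus_neq0.
exact: coord_continuous.
Qed.

Lemma monomial1 n (a : 'I_n -> int) : monomial a (const_mx 1 : 'rV[C]_n) = 1.
Proof. by rewrite /monomial big1// => j _; rewrite mxE exp1rz. Qed.

End Monomials.

(** * Arcs on the unit circle *)

Lemma real_complex_continuous (R : realType) :
  continuous (fun x : R => x%:C%C : CC R).
Proof.
move=> x D /nbhs_ballP[e /= e0 eD].
(* Balls of [CC R] have complex radii; a positive radius equals its real part, which serves as the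
   radius in [R]. *)
have eE := RRe_real (gtr0_real e0).
apply/nbhs_ballP; exists (complex.Re e) => /=; first by rewrite -ltcR eE.
move=> y; rewrite -ball_normE /= => xy; apply: eD; rewrite -ball_normE /=.
rewrite -[x%:C%C - _](rmorphB (real_complex R)) [`|_%:C%C|]normc_def /=.
by rewrite expr0n addr0 sqrtr_sqr -eE ltcR.
Qed.

(** The arc is [exp(i t th)] for an argument [th] of [z]. It serves to join points of the identity
    component to 1. *)
Lemma unit_circle_arc (R : realType) (z : CC R) : `|z| = 1 ->
  exists gamma : R -> CC R, [/\ continuous gamma, gamma 0 = 1, gamma 1 = z &
    forall t, `|gamma t| = 1].
Proof.
case: z => a b; rewrite [`|_|]normc_def => -[/= ab].
have {}ab : a ^+ 2 + b ^+ 2 = 1.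
  by rewrite -[LHS]sqr_sqrtr ?addr_ge0 ?sqr_ge0// ab expr1n.
have b2 : b ^+ 2 = 1 - a ^+ 2 by rewrite -ab addrAC subrr add0r.
have a1 : -1 <= a <= 1.
  rewrite -ler_norml -(@expr_le1 _ 2)//.
  by rewrite real_normK ?num_real// -ab lerDl sqr_ge0.
(* [acos] yields an angle with nonnegative sine, so its sign is changed when [b] is negative. *)
have [th [cth sth]] : exists th : R, cos th = a /\ sin th = b.
  have [b0|b0] := leP 0 b.
    exists (acos a); rewrite acosK ?in_itv//= sin_acos// -b2 sqrtr_sqr.
    by rewrite ger0_norm.
  exists (- acos a); rewrite cosN sinN acosK ?in_itv//= sin_acos// -b2.
  by rewrite sqrtr_sqr ltr0_norm ?opprK.
have lin : continuous (fun t : R => t * th).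
  by move=> t; exact: mulrr_continuous.
have lift (h : R -> R) : continuous h ->
    continuous (fun t : R => (h (t * th))%:C%C : CC R).
  move=> ch t; apply: (@continuous_comp _ _ _ (fun t : R => h (t * th))
    (fun x => x%:C%C : CC R)); last exact: real_complex_continuous.
  exact: (continuous_comp (lin t) (ch _)).
exists (fun t => (cos (t * th) +i* sin (t * th))%C); split.
- move=> t.
  have -> : (fun t => (cos (t * th) +i* sin (t * th))%C : CC R) =
      (fun t => (cos (t * th))%:C%C + 'i%C * (sin (t * th))%:C%C).
    by apply/funext => s; rewrite [LHS]complexE.
  apply: cvgD; first by apply: lift; exact: continuous_cos.
  apply: cvgM; first exact: cvg_cst.
  by apply: lift; exact: continuous_sin.
- by rewrite mul0r cos0 sin0.
- by rewrite mul1r cth sth.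
- by move=> t; rewrite [`|_|]normc_def /= cos2Dsin2 sqrtr1.
Qed.

(** * The Serre-Frobenius group *)

Section AngleBasis.
Variables (R : realType) (g delta m : nat) (u : 'rV[CC R]_g).
Local Notation C := (CC R).

(** The exponents are kept as data because they define the monomial maps in both directions: [A] and
    [b] express the new generators in [u], [B] and [c] express [u] in them. *)
Record angle_basis (A : 'I_delta -> 'I_g -> int) (b : 'I_g -> int)
    (B : 'I_g -> 'I_delta -> int) (c : 'I_g -> int)
    (v : 'rV[C]_delta) (zeta : C) : Prop := AngleBasis {
  basis_free : forall i, v 0 i = monomial (A i) u;
  basis_torsion : zeta = monomial b u;
  basis_gen : forall j, u 0 j = monomial (B j) v * zeta ^ c j;
  basis_indep : forall a, monomial a v = 1 -> forall i, a i = 0;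
  basis_prim : m.-primitive_root zeta }.

(** The [v_i] are the images of the standard basis vectors and [zeta] is the image of the generator
    of the last factor. The kernel of [f] gives independence and primitivity, its image gives the
    exponents. *)
Lemma angle_decomp_basis : (0 < m)%N -> angle_decomp u delta m ->
  exists A b B c v zeta, angle_basis A b B c v zeta.
Proof.
move=> m0 [f [fD f1 fu]].
have f00 : f (fun=> 0) 0 = 1 by apply/f1; split=> //; exact: dvdz0.
have fM n a k : f (fun i => n * a i) (n * k) = f a k ^ n.
  have fMn (p : nat) : f (fun i => p%:Z * a i) (p%:Z * k) = f a k ^+ p.
    elim: p => [|p IHp].
      rewrite expr0 mul0r -[RHS]f00; congr f.
      by apply/funext => i; rewrite mul0r.
    rewrite exprS -IHp -fD intS mulrDl mul1r; congr f; apply/funext => i.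
    by rewrite mulrDl mul1r.
  case: n => p; first exact: fMn.
  have prod1 : f (fun i => Negz p * a i) (Negz p * k) * f a k ^+ p.+1 = 1.
    rewrite -fMn -fD -[RHS]f00 NegzE mulNr addNr; congr f; apply/funext => i.
    by rewrite mulNr addNr.
  (* Values of [f] are invertible, which makes the case of negative exponents meaningful. *)
  have f0 : f a k ^+ p.+1 != 0.
    by apply: contra_eq_neq prod1 => ->; rewrite mulr0 eq_sym oner_eq0.
  by apply: (mulIf f0); rewrite prod1 /= mulVf.
pose e (i j : 'I_delta) : int := (j == i)%:Z.
pose v : 'rV[C]_delta := \row_i f (e i) 0.
pose zeta := f (fun=> 0) 1.
have fE a k : f a k = monomial a v * zeta ^ k.
  rewrite /zeta -fM mulr1.
  have -> : monomial a v = f a 0.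
    rewrite /monomial.
    transitivity (f (fun j => \sum_i a i * e i j) 0); last first.
      congr f; apply/funext => j.
      rewrite (bigD1 j)//= big1 /e ?eqxx ?mulr1 ?addr0//.
      by move=> i; rewrite eq_sym => /negbTE ->; rewrite mulr0.
    rewrite /index_enum; elim: (Finite.enum _) => [|i s IHs].
      by rewrite big_nil -f00; congr f; apply/funext => j; rewrite big_nil.
    rewrite big_cons IHs mxE -fM mulr0 -fD addr0; congr f; apply/funext => j.
    by rewrite big_cons.
  by rewrite -fD add0r; congr f; apply/funext => i; rewrite mulr0 addr0.
have fA a k : exists s : 'I_g -> int, f a k = monomial s u.
  have : angle_group u (f a k) by rewrite -fu; exists a, k.
  by move=> [s _ <-]; exists s.
have uB j : exists ak : ('I_delta -> int) * int,
    u 0 j = monomial ak.1 v * zeta ^ ak.2.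
  have : angle_group u (u 0 j).
    exists (fun i => (i == j)%:Z) => //.
    rewrite (bigD1 j)//= eqxx expr1z big1 ?mulr1// => i /negbTE ->.
    by rewrite expr0z.
  by rewrite -fu => -[a [k <-]]; exists (a, k); rewrite fE.
have [A AE] := choice (fun i => fA (e i) 0).
have [b bE] := fA (fun=> 0) 1.
have [Bc BcE] := choice uB.
exists A, b, (fun j => (Bc j).1), (fun j => (Bc j).2), v, zeta.
split => // [i|a a1|].
- by rewrite mxE.
- have /f1[] : f a 0 = 1 by rewrite fE a1 expr0z mulr1.
  by [].
(* The kernel condition says that [zeta] has order exactly [m]. *)
have zP (k : nat) : (zeta ^+ k == 1) = (m %| k)%N.
  apply/eqP/idP => [zk|mk].
    suff /f1[_] : f (fun=> 0) k%:Z = 1 by [].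
    by rewrite fE -exprnP zk mulr1 /monomial big1// => i _; rewrite expr0z.
  have : f (fun=> 0) k%:Z = 1 by apply/f1.
  by rewrite fE /monomial big1 ?mul1r// => i _; rewrite expr0z.
apply/andP; split=> //; apply/forallP => i; rewrite unity_rootE zP.
apply/eqP; have [->|iN] := eqVneq i.+1 m; first by rewrite dvdnn.
apply/negbTE/negP => /(dvdn_leq (ltn0Sn _)) mi.
by move: iN; rewrite eqn_leq ltn_ord mi.
Qed.

End AngleBasis.

(** * The isomorphism with the torus times the roots of unity *)

Section SerreFrobenius.
Variables (R : realType) (g delta m : nat) (u : 'rV[CC R]_g).
Local Notation C := (CC R).
Variables (A : 'I_delta -> 'I_g -> int) (b : 'I_g -> int).
Variables (B : 'I_g -> 'I_delta -> int) (c : 'I_g -> int).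
Variables (v : 'rV[C]_delta) (zeta : C).
Hypothesis m_gt0 : (0 < m)%N.
Hypothesis u_torus : torus u.
Hypothesis Abasis : angle_basis m u A b B c v zeta.

Definition basis_coord (x : 'rV[C]_g) : 'rV[C]_delta * C :=
  (\row_i monomial (A i) x, monomial b x).

Definition basis_eval (yz : 'rV[C]_delta * C) : 'rV[C]_g :=
  \row_j (monomial (B j) yz.1 * yz.2 ^ c j).

Local Notation phi := basis_coord.
Local Notation psi := basis_eval.
Local Notation SF := (SFgroup u).
Let T : set ('rV[C]_delta * C) := [set yz | torus yz.1 /\ mu m yz.2].

Lemma mu_norm (z : C) : mu m z -> `|z| = 1.
Proof.
move=> zm; apply/eqP; rewrite -(@pexpr_eq1 _ _ m)//.
by rewrite -normrX zm normr1.
Qed.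

Lemma basis_torus : torus v.
Proof. by move=> i; rewrite (basis_free Abasis) norm_monomial. Qed.

Lemma zeta_mu : mu m zeta.
Proof. exact: prim_expr_order (basis_prim Abasis). Qed.

Lemma zeta_expz_mu k : mu m (zeta ^ k).
Proof.
by rewrite /mu /= -[_ ^+ m]/(_ ^ m%:Z) exprzAC -exprnP zeta_mu exp1rz.
Qed.

Lemma basis_coord_rexp k : phi (rexp u k) = (rexp v k, zeta ^ k).
Proof.
rewrite /phi monomial_rexp -(basis_torsion Abasis); congr pair.
by apply/rowP => i; rewrite !mxE monomial_rexp (basis_free Abasis).
Qed.

Lemma basis_eval_rexp k : psi (rexp v k, zeta ^ k) = rexp u k.
Proof.
apply/rowP => j; rewrite !mxE monomial_rexp (basis_gen Abasis) expfzMl.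
by rewrite /= !exprz_exp mulrC [k * _]mulrC mulrC.
Qed.

Lemma basis_coordM x y :
  phi (rmul x y) = (rmul (phi x).1 (phi y).1, (phi x).2 * (phi y).2).
Proof.
rewrite /phi monomialM; congr pair.
by apply/rowP => i; rewrite !mxE monomialM.
Qed.

Lemma basis_evalM y z y' z' :
  psi (rmul y y', z * z') = rmul (psi (y, z)) (psi (y', z')).
Proof. by apply/rowP => j; rewrite !mxE /= monomialM expfzMl mulrACA. Qed.

Lemma basis_eval_torus yz : T yz -> torus (psi yz).
Proof.
move=> [yT zm] j; rewrite mxE normrM norm_monomial// norm_exprz1 ?mulr1//.
exact: mu_norm.
Qed.

Lemma basis_coord_continuous x : torus x -> {for x, continuous phi}.
Proof.
move=> xT.
have crow : {for x, continuous (fun x => \row_i monomial (A i) x)}.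
  apply: continuous_at_row => i.
  rewrite /prop_for /continuous_at mxE; under eq_fun do rewrite mxE.
  exact: monomial_continuous.
move=> D [[U V] /= [Ux Vx] UVD].
have {}Ux : nbhs x ((fun x => \row_i monomial (A i) x) @^-1` U) := crow _ Ux.
have {}Vx : nbhs x (monomial b @^-1` V) := monomial_continuous xT Vx.
by apply: filterS (filterI Ux Vx) => t [Ut Vt]; exact: UVD.
Qed.

Lemma basis_eval_continuous yz : T yz -> {for yz, continuous psi}.
Proof.
move=> [yT zm]; apply: continuous_at_row => j.
rewrite /prop_for /continuous_at mxE; under eq_fun do rewrite mxE.
apply: cvgM.
  apply: (@continuous_comp _ _ _ fst (monomial (B j))); first exact: cvg_fst.
  exact: monomial_continuous.
apply: continuous_at_exprz; first exact: cvg_snd.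
by rewrite -normr_eq0 mu_norm// oner_eq0.
Qed.

(** Kronecker's theorem for [v ^ m] with target [y / v ^ r]; multiplying by [v ^ r], of norm 1,
    keeps distances. Fixing the exponent modulo [m] keeps control of the power of [zeta]. *)
Lemma dense_residue (y : 'rV[C]_delta) (r : nat) (U : set 'rV[C]_delta) :
  torus y -> nbhs y U -> exists k : nat, U (rexp v (m * k + r)%N%:Z).
Proof.
move=> yT /nbhs_ballP[e e0 eU].
have v0 i : v 0 i != 0 by apply: torus_neq0; exact: basis_torus.
have [||||k kP] := @Kronecker_density R delta (fun i => v 0 i ^+ m)
    (fun i => y 0 i / v 0 i ^+ r) e.
- by move=> i; rewrite normrX basis_torus expr1n.
- by move=> i; rewrite normrM normfV normrX basis_torus yT expr1n divr1.
- move=> a a1 i.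
  (* A relation with exponents [a] among the [v_i ^ m] is one with exponents [m * a] among the
     [v_i]. *)
  suff /(basis_indep Abasis)/(_ i)/eqP : monomial (fun i => m%:Z * a i) v = 1.
    by rewrite mulf_eq0 eqz_nat -[_ == 0%N]negbK -lt0n m_gt0 => /eqP.
  by rewrite -a1; apply: eq_bigr => j _; rewrite -exprz_exp.
- exact: e0.
exists k; apply: eU; split=> // i j; rewrite ord1 -ball_normE /= mxE distrC.
rewrite -exprnP exprD exprM.
have -> : v 0 j ^+ m ^+ k * v 0 j ^+ r - y 0 j =
    v 0 j ^+ r * (v 0 j ^+ m ^+ k - y 0 j / v 0 j ^+ r).
  by rewrite mulrBr [_ * (_ / _)]mulrC divfK ?expf_neq0// mulrC.
by rewrite normrM normrX basis_torus expr1n mul1r.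
Qed.

Lemma zeta_residue (k r : nat) : zeta ^ (m * k + r)%N%:Z = zeta ^+ r.
Proof. by rewrite -exprnP exprD exprM zeta_mu expr1n mul1r. Qed.

(** The root of unity is hit exactly by choosing the residue [r]; the torus coordinate is
    approximated within that residue class. *)
Lemma basis_powers_dense yz :
  T yz -> closure [set (rexp v k, zeta ^ k) | k in [set: int]] yz.
Proof.
case: yz => y z [/= yT zm] D [[U V] /= [Uy Vz] UVD].
have [r zr] := prim_rootP (basis_prim Abasis) zm.
have [k Uk] := dense_residue r yT Uy.
exists (rexp v (m * k + r)%N%:Z, zeta ^ (m * k + r)%N%:Z).
split; first by eexists.
by apply: UVD; split => //=; rewrite zeta_residue -zr; exact: nbhs_singleton.
Qed.

Lemma SF_torus : SF `<=` @torus R g.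
Proof. by apply: torus_closure => _ [k _ <-]; exact: torus_rexp. Qed.

Lemma rexp_SF k : SF (rexp u k).
Proof. by apply: subset_closure; exists k. Qed.

Lemma basis_eval_SF yz : T yz -> SF (psi yz).
Proof.
move=> yzT; have := basis_eval_continuous yzT.
move=> /(closure_image_at (basis_powers_dense yzT)).
rewrite image_comp; apply: closureS => _ [k _ <-] /=.
by exists k => //; rewrite basis_eval_rexp.
Qed.

(** Holds on the dense powers of [(v, zeta)] and passes to the closure, with no comparison of
    exponents. *)
Lemma basis_evalK yz : T yz -> phi (psi yz) = yz.
Proof.
move=> yzT; have cpsi := basis_eval_continuous yzT.
have psiT := basis_eval_torus yzT.
apply: (closure_eq_at (f := phi \o psi) (g := id) _ (basis_powers_dense yzT)).
- exact: norm_hausdorff.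
- by apply: continuous_comp => //; exact: basis_coord_continuous.
- by move=> D.
- by move=> _ [k _ <-]; rewrite /= basis_eval_rexp basis_coord_rexp.
Qed.

Lemma basis_coord_SF x : SF x -> T (phi x).
Proof.
move=> xSF; have xT := SF_torus xSF; split.
  by move=> i; rewrite mxE norm_monomial.
rewrite /mu /=.
apply: (closure_eq_at (f := fun x => monomial b x ^ m%:Z) (g := fun=> 1 : C)
  (@CC_hausdorff R) xSF).
- apply: continuous_at_exprz.
    exact: monomial_continuous.
  by rewrite -normr_eq0 norm_monomial// oner_eq0.
- exact: cst_continuous.
- move=> _ [k _ <-]; rewrite monomial_rexp -(basis_torsion Abasis).
  exact: zeta_expz_mu.
Qed.

Lemma basis_coordK x : SF x -> psi (phi x) = x.
Proof.
move=> xSF; have xT := SF_torus xSF; have phiT := basis_coord_SF xSF.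
apply: (closure_eq_at (f := psi \o phi) (g := id) _ xSF).
- exact: norm_hausdorff.
- apply: continuous_comp; first exact: basis_coord_continuous.
  exact: basis_eval_continuous.
- by move=> D.
- by move=> _ [k _ <-]; rewrite /= basis_coord_rexp basis_eval_rexp.
Qed.

Lemma SF_topgroup_iso : topgroup_iso SF T.
Proof.
exists phi, psi; split.
- by split; [exact: basis_coord_SF | exact: basis_eval_SF].
- by split; [exact: basis_coordK | exact: basis_evalK].
- by move=> x y _ _; exact: basis_coordM.
- apply: continuous_in_subspaceT => x /set_mem xSF.
  exact/basis_coord_continuous/SF_torus.
- apply: continuous_in_subspaceT => yz /set_mem yzT.
  exact: basis_eval_continuous.
Qed.

(** * The identity component *)

Let H : set 'rV[C]_g := [set x | SF x /\ (phi x).2 = 1].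

(** The powers of [u ^ m] have last coordinate 1, a closed condition. Conversely, residue 0 in
    [dense_residue] approximates any [(y, 1)] by powers with exponent divisible by [m], and [psi]
    carries this back. *)
Lemma SF_rexpE : SFgroup (rexp u m%:Z) = H.
Proof.
have rexpA k : rexp (rexp u m%:Z) k = rexp u (m%:Z * k).
  by apply/rowP => j; rewrite !mxE exprz_exp.
apply/seteqP; split=> [x xSF|x [xSF x1]].
  have xSFu : SF x.
    apply: closureS xSF => _ [k _ <-].
    by exists (m%:Z * k).
  split=> //; apply: (closure_eq_at (f := monomial b) (g := fun=> 1 : C) _ xSF).
  - exact: CC_hausdorff.
  - exact/monomial_continuous/SF_torus.
  - exact: cst_continuous.
  - move=> _ [k _ <-]; rewrite rexpA monomial_rexp -(basis_torsion Abasis).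
    by rewrite -exprz_exp -exprnP zeta_mu exp1rz.
have phiT := basis_coord_SF xSF.
move=> D; rewrite -{1}(basis_coordK xSF) => xD.
have : nbhs (phi x) (psi @^-1` D) := basis_eval_continuous phiT xD.
case: (phi x) phiT x1 => y z [/= yT _] -> [[U V] /= [Uy V1] UVD].
have [k Uk] := dense_residue 0 yT Uy; rewrite addn0 in Uk.
exists (rexp u (m%:Z * k%:Z)); split; first by exists k%:Z.
have -> : rexp u (m%:Z * k%:Z) = psi (rexp v (m * k)%N%:Z, 1).
  rewrite -PoszM -basis_eval_rexp; congr (psi (_, _)).
  by rewrite -[RHS](expr0 zeta) -(zeta_residue k 0) addn0.
by apply: UVD; split => //=; exact: nbhs_singleton.
Qed.

Lemma mu_finite : finite_set (mu (R := R) m).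
Proof.
apply: (@sub_finite_set _ _ [set zeta ^+ (val i) | i in [set: 'I_m]]).
  by move=> z /(prim_rootP (basis_prim Abasis))[i ->]; exists i.
exact/finite_image/finite_finset.
Qed.

Lemma SF1 : SF (const_mx 1).
Proof.
have -> : const_mx 1 = rexp u 0 by apply/rowP => j; rewrite !mxE expr0z.
exact: rexp_SF.
Qed.

Lemma basis_coord1 : phi (const_mx 1) = (const_mx 1, 1).
Proof.
rewrite /phi monomial1; congr pair.
by apply/rowP => i; rewrite !mxE monomial1.
Qed.

Lemma basis_eval1 : psi (const_mx 1, 1) = const_mx 1.
Proof. by rewrite -basis_coord1 basis_coordK//; exact: SF1. Qed.

(** The last coordinate maps a connected set containing the identity to a connected subset of the
    finite set [mu m], hence to 1. Conversely, a point of [H] is joined to the identity by the image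
    under [psi] of a path of arcs. *)
Lemma component_SF : connected_component SF (const_mx 1) = H.
Proof.
apply/seteqP; split=> [x [D [D1 DSF Dc] Dx]|x [xSF x1]].
  split; first exact: DSF.
  pose E := monomial b @` D.
  have Ec : connected E.
    apply: connected_continuous_connected => //.
    apply: continuous_in_subspaceT => y /set_mem /DSF ySF.
    exact/monomial_continuous/SF_torus.
  have E1 : E 1 by exists (const_mx 1) => //; rewrite monomial1.
  have finC : forall F : set C, finite_set F -> closed F.
    exact/accessible_finite_set_closed/hausdorff_accessible/CC_hausdorff.
  (* The singleton is relatively open in [E], being cut out by the complement of the finite set
     [mu m] without 1, and it is closed. *)
  have : [set 1] = E.
    apply: Ec; first by exists 1.
      exists (~` (mu (R := R) m `\ 1)).
        apply: closed_openC; apply: finC.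
        by apply: sub_finite_set mu_finite => z [].
      apply/seteqP; split=> [_ ->|z [Ez /not_andP[]]]; first by split=> //= -[].
        by case: Ez => y /DSF ySF <- []; have [_] := basis_coord_SF ySF.
      by move=> /contrapT.
    exists [set 1]; first exact: finC (finite_set1 _).
    by apply/seteqP; split=> [_ ->|z []].
  by move=> E1E; have : E (phi x).2 by [exists x]; rewrite -E1E.
have phiT := basis_coord_SF xSF.
have arcs i : exists gamma : R -> C, [/\ continuous gamma, gamma 0 = 1,
    gamma 1 = (phi x).1 0 i & forall t, `|gamma t| = 1].
  by apply: unit_circle_arc; case: phiT => ->.
have [gamma gammaP] := choice arcs.
pose path (t : R) : 'rV[C]_delta * C := (\row_i gamma i t, 1).
have pathT t : T (path t).
  split; last by rewrite /mu /= expr1n.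
  by move=> i; rewrite mxE; have [] := gammaP i.
have path_cont t : {for t, continuous path}.
  have crow : {for t, continuous (fun t => \row_i gamma i t)}.
    apply: continuous_at_row => i; rewrite /prop_for /continuous_at mxE.
    under eq_fun do rewrite mxE.
    by have [cg _ _ _] := gammaP i; exact: cg.
  move=> D [[U V] /= [Ut Vt] UVD].
  have {}Ut : nbhs t ((fun t => \row_i gamma i t) @^-1` U) := crow _ Ut.
  by apply: filterS Ut => s Us; apply: UVD; split => //=; exact: nbhs_singleton.
apply: (@connected_component_max _ SF (range (psi \o path))).
- exists 0 => //=; rewrite -basis_eval1; congr (psi (_, _)); apply/rowP => i.
  by rewrite !mxE; have [] := gammaP i.
- by move=> _ [t _ <-]; exact: basis_eval_SF.
- apply: connected_continuous_connected; first by apply/connected_intervalP.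
  apply: continuous_in_subspaceT => t _.
  exact: (continuous_comp (path_cont t) (basis_eval_continuous (pathT t))).
exists 1 => //=; rewrite -[RHS](basis_coordK xSF).
rewrite [in RHS](surjective_pairing (phi x)) x1.
congr (psi (_, _)); apply/rowP => i.
by rewrite mxE; have [] := gammaP i.
Qed.

(** * The component group *)

(** The last coordinate is a homomorphism from [SF] onto [mu m] with kernel [H]. *)
Lemma quotient_SF : quotient_iso_mu m SF H.
Proof.
have H1 : H (const_mx 1) by split; [exact: SF1 | rewrite basis_coord1].
have rmul1 (x : 'rV[C]_g) : rmul x (const_mx 1) = x.
  by apply/rowP => j; rewrite !mxE mulr1.
(* The coordinate is read off a chosen representative; the default is never reached on a coset, and
   [FE] shows that the choice does not matter. *)
pose F (S : set 'rV[C]_g) := (phi (xget (const_mx 1) S)).2.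
have FE x : F (coset H x) = (phi x).2.
  have : coset H x (xget (const_mx 1) (coset H x)).
    by apply: (@xgetI _ _ _ x); exists (const_mx 1).
  by rewrite /F => -[h [_ h1] <-]; rewrite basis_coordM /= [X in _ * X]h1 mulr1.
(* Closure under products, and under inverses further on, is transported from the product group
   through [psi]. *)
have SFM x y : SF x -> SF y -> SF (rmul x y).
  move=> xSF ySF; rewrite -(basis_coordK xSF) -(basis_coordK ySF).
  have [xT xm] := basis_coord_SF xSF; have [yT ym] := basis_coord_SF ySF.
  case: (phi x) (phi y) xT xm yT ym => [a z] [a' z'] /= aT zm aT' zm'.
  rewrite -basis_evalM; apply: basis_eval_SF; split; first exact: torus_rmul.
  by rewrite /mu /= exprMn zm zm' mulr1.
have sub x y : SF x -> SF y -> (phi x).2 = (phi y).2 ->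
    coset H x `<=` coset H y.
  move=> xSF ySF xy _ [h [hSF h1] <-].
  have yT := SF_torus ySF.
  pose yi := rexp y (-1).
  have yiSF : SF yi.
    have [pyT pym] := basis_coord_SF ySF.
    have -> : yi = psi (rexp (phi y).1 (-1), (phi y).2 ^ (-1)).
      rewrite /yi -{1}(basis_coordK ySF); apply/rowP => j; rewrite !mxE /=.
      by rewrite monomial_rexp expfzMl !exprz_exp mulrC [-1 * _]mulrC mulrC.
    apply: basis_eval_SF; split; first exact: torus_rexp.
    by rewrite /mu /= -[_ ^+ m]/(_ ^ m%:Z) exprzAC -exprnP pym exp1rz.
  have yiE : rmul y yi = const_mx 1.
    by apply/rowP => j; rewrite !mxE exprN1 divff ?torus_neq0.
  have rmulA (s t w : 'rV[C]_g) : rmul s (rmul t w) = rmul (rmul s t) w.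
    by apply/rowP => j; rewrite !mxE mulrA.
  (* Write [x h = y (y^-1 x h)]; the factor in parentheses has last coordinate 1 because [x] and [y]
     agree there. *)
  exists (rmul yi (rmul x h)).
    split; first exact: SFM _ _ yiSF (SFM _ _ xSF hSF).
    have bh : monomial b h = 1 := h1.
    have bx : monomial b x = monomial b y := xy.
    by rewrite /= !monomialM bh bx mulr1 mulrC -monomialM yiE monomial1.
  by rewrite rmulA yiE; apply/rowP => j; rewrite !mxE mul1r.
exists F; split.
- by move=> x xSF; rewrite FE; case: (basis_coord_SF xSF).
- move=> x y xSF ySF; rewrite !FE => xy.
  by apply/seteqP; split; apply: sub.
- move=> z zm.
  have zT : T (const_mx 1, z) by split => //; exact: torus1.
  exists (psi (const_mx 1, z)); first exact: basis_eval_SF.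
  by rewrite FE basis_evalK.
- by move=> x y xSF ySF; rewrite !FE basis_coordM.
Qed.

End SerreFrobenius.

Theorem theoremE (R : realType) (p d g : nat) (alpha : 'I_g -> CC R)
    (delta m : nat) :
  prime p -> (0 < d)%N ->
  (* |alpha_j| = sqrt q, q = p^d *)
  (forall j, `|alpha j| ^+ 2 = (p ^ d)%:R) ->
  (* alpha_1..alpha_g, conj alpha_1..conj alpha_g are the roots (with
     multiplicity) of an integer polynomial (P_A) *)
  (exists P : {poly int},
     map_poly intr P = \prod_(j < g) (('X - (alpha j)%:P) * ('X - (alpha j)^*%:P))) ->
  let u : 'rV[CC R]_g := \row_j (alpha j / `|alpha j|) in
  (0 < m)%N ->
  angle_decomp u delta m ->
  [/\ topgroup_iso (SFgroup u)
        [set x : 'rV[CC R]_delta * CC R | torus x.1 /\ mu m x.2],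
      connected_component (SFgroup u) (const_mx 1) = SFgroup (rexp u m%:Z) &
      quotient_iso_mu m (SFgroup u) (connected_component (SFgroup u) (const_mx 1))].
Proof.
move=> p_prime _ alphaq _ u m_gt0 dec.
have u_torus : torus u.
  move=> j; rewrite mxE normrM normfV normr_id divff//.
  apply: contra_eq_neq (alphaq j) => ->.
  by rewrite expr0n eq_sym pnatr_eq0 expn_eq0 negb_and -lt0n prime_gt0.
have [A [b [B [c [v [zeta basis]]]]]] := angle_decomp_basis m_gt0 dec.
(* Both the identity component and the group of [u ^ m] become the kernel of the last coordinate on
   [SFgroup u]. *)
rewrite (component_SF m_gt0 u_torus basis) (SF_rexpE m_gt0 u_torus basis).
split=> //; first exact: SF_topgroup_iso basis.
exact: quotient_SF basis.
Qed.
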